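(* The following are equivalent for a variety $\mathcal V$. (1) $\mathcal V$ has a difference term. (2) $\mathcal V$ has a Taylor term and the commutator is commutative throughout $\mathcal V$ (that is, $[x,y]=[y,x]$ for all $\mathbf A\in\mathcal V$ and all $x,y\in\mathrm{Con}(\mathbf A)$). (3) $\mathcal V$ has a Taylor term and the commutator operation is commutative on pairs of comparable congruences (that is, $[x,y]=[y,x]$ for all $\mathbf A\in\mathcal V$ and all $x,y\in\mathrm{Con}(\mathbf A)$ with $x\leq y$).
   Context: A variety is an equationally defined class of algebras of a fixed (arbitrary) signature. $\mathrm{Con}(\mathbf A)$ is the congruence lattice of $\mathbf A$, with meet $\cap$, join $+$, and least element $0$ (the equality relation). For $\alpha,\beta\in\mathrm{Con}(\mathbf A)$, an $\alpha,\beta$-matrix is a matrix $\begin{bmatrix}p&q\\ r&s\end{bmatrix}=\begin{bmatrix}t(\mathbf a,\mathbf u)&t(\mathbf a,\mathbf v)\\ t(\mathbf b,\mathbf u)&t(\mathbf b,\mathbf v)\end{bmatrix}$, where $t$ is an $(m+n)$-ary term operation of $\mathbf A$, $(a_i,b_i)\in\alpha$ for all $i$ and $(u_j,v_j)\in\beta$ for all $j$. For $\delta\in\mathrm{Con}(\mathbf A)$, the relation $C(\alpha,\beta;\delta)$ holds if for every $\alpha,\beta$-matrix $\begin{bmatrix}p&q\\ r&s\end{bmatrix}$, $(p,q)\in\delta$ implies $(r,s)\in\delta$. The commutator $[\alpha,\beta]$ is the least congruence $\delta$ such that $C(\alpha,\beta;\delta)$ holds. A congruence $\alpha$ is abelian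 if $[\alpha,\alpha]=0$. A Taylor term for $\mathcal V$ is a term $T(x_1,\ldots,x_n)$ such that $\mathcal V\models T(x,\ldots,x)\approx x$ and, for each $i\in\{1,\ldots,n\}$, $\mathcal V$ satisfies some identity $T(\mathbf w)\approx T(\mathbf z)$ where $\mathbf w,\mathbf z$ are $n$-tuples of variables and $w_i\neq z_i$ are different variables. A difference term for $\mathcal V$ is a ternary term $t(x,y,z)$ such that $\mathcal V\models t(x,x,y)\approx y$ and, for every $\mathbf B\in\mathcal V$, $t^{\mathbf B}(a,b,b)=a$ whenever $(a,b)$ is contained in an abelian congruence of $\mathbf B$. *)

(* Defs.v *)
From Stdlib Require Import RelationClasses FunctionalExtensionality.
From mathcomp Require Import all_boot.

Set Implicit Arguments.
Unset Strict Implicit.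
Unset Printing Implicit Defensive.

Record signature := Signature {
  op : Type;
  arity : op -> nat
}.

Record algebra (S : signature) := Algebra {
  carrier :> Type;
  interp : forall f : op S, ('I_(arity f) -> carrier) -> carrier;
  carrier_inhabited : inhabited carrier
}.

Section Terms.
Variable S : signature.

Inductive term (X : Type) : Type :=
| Var (x : X)
| App (f : op S) (args : 'I_(arity f) -> term X).

Fixpoint eval (A : algebra S) (X : Type) (e : X -> A) (t : term X) : A :=
  match t with
  | Var x => e x
  | App f args => interp (fun i => eval e (args i))
  end.

Fixpoint subst (X Y : Type) (s : X -> term Y) (t : term X) : term Y :=
  match t with
  | Var x => s x
  | App f args => App (fun i => subst s (args i))
  end.

Definition satisfies (A : algebra S) (X : Type) (p q : term X) : Prop :=
  forall e : X -> A, eval e p = eval e q.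

Definition is_variety (V : algebra S -> Prop) : Prop :=
  exists E : term nat -> term nat -> Prop,
    forall A : algebra S, V A <-> (forall p q, E p q -> satisfies A p q).

(* V |= p ~ q *)
Definition models (V : algebra S -> Prop) (X : Type) (p q : term X) : Prop :=
  forall A : algebra S, V A -> satisfies A p q.

End Terms.

Arguments Var {S X} x.
Arguments App {S X} f args.

Section Congruences.
Variables (S : signature) (A : algebra S).

Record con := Con {
  con_rel :> A -> A -> Prop;
  con_equiv : Equivalence con_rel;
  con_compat : forall (f : op S) (a b : 'I_(arity f) -> A),
    (forall i, con_rel (a i) (b i)) -> con_rel (interp a) (interp b)
}.

(* Con(A) is ordered by inclusion; equality of congruences is equality of the
   underlying sets of pairs. *)
Definition con_le (x y : con) : Prop := forall a b : A, x a b -> y a b.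
Definition con_eq (x y : con) : Prop := forall a b : A, x a b <-> y a b.

Lemma con0_compat (f : op S) (a b : 'I_(arity f) -> A) :
  (forall i, a i = b i) -> interp a = interp b.
Proof.
by move=> ab; congr interp; apply: functional_extensionality.
Qed.

Definition con0 : con := Con (@eq_equivalence A) con0_compat.

Definition join_env (m n : nat) (a : 'I_m -> A) (u : 'I_n -> A)
    (i : 'I_m + 'I_n) : A :=
  match i with inl j => a j | inr k => u k end.

(* [p q; r s] is an alpha,beta-matrix.  The m + n variables of the term t are
   indexed by the disjoint union of 'I_m and 'I_n. *)
Definition is_matrix (alpha beta : con) (p q r s : A) : Prop :=
  exists (m n : nat) (t : term S ('I_m + 'I_n)%type)
         (a b : 'I_m -> A) (u v : 'I_n -> A),
    [/\ forall i, alpha (a i) (b i),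
        forall j, beta (u j) (v j),
        (p = eval (join_env a u) t) /\ (q = eval (join_env a v) t) &
        (r = eval (join_env b u) t) /\ (s = eval (join_env b v) t)].

(* C(alpha, beta; delta) *)
Definition centralizes (alpha beta delta : con) : Prop :=
  forall p q r s : A,
    is_matrix alpha beta p q r s -> delta p q -> delta r s.

(* The least delta with C(alpha, beta; delta) is constructed as the
   intersection of all of them; commutator_centralizes and commutator_least
   show that this intersection is indeed the least one. *)
Definition commutator_rel (alpha beta : con) (a b : A) : Prop :=
  forall delta : con, centralizes alpha beta delta -> delta a b.

Lemma commutator_equiv (alpha beta : con) :
  Equivalence (commutator_rel alpha beta).
Proof.
split.
- by move=> a d _; have [r _ _] := con_equiv d; apply: r.
- by move=> a b ab d /[dup] C /ab; have [_ s _] := con_equiv d; apply: s.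
- move=> a b c ab bc d C; have [_ _ t] := con_equiv d.
  exact: t (ab d C) (bc d C).
Qed.

Lemma commutator_compat (alpha beta : con) (f : op S)
    (a b : 'I_(arity f) -> A) :
  (forall i, commutator_rel alpha beta (a i) (b i)) ->
  commutator_rel alpha beta (interp a) (interp b).
Proof. by move=> ab d C; apply: con_compat => i; apply: ab. Qed.

Definition commutator (alpha beta : con) : con :=
  Con (commutator_equiv alpha beta) (@commutator_compat alpha beta).

Lemma commutator_centralizes (alpha beta : con) :
  centralizes alpha beta (commutator alpha beta).
Proof. by move=> p q r s M pq d C; apply: C M (pq d C). Qed.

Lemma commutator_least (alpha beta delta : con) :
  centralizes alpha beta delta -> con_le (commutator alpha beta) delta.
Proof. by move=> C a b; apply. Qed.

Definition abelian (alpha : con) : Prop := con_eq (commutator alpha alpha) con0.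

End Congruences.

Section MaltsevConditions.
Variables (S : signature) (V : algebra S -> Prop).

Definition is_taylor_term (n : nat) (T : term S 'I_n) : Prop :=
  models V (subst (fun=> Var 0) T) (Var 0) /\
  forall i : 'I_n, exists w z : 'I_n -> nat,
    w i <> z i /\ models V (subst (Var \o w) T) (subst (Var \o z) T).

Definition has_taylor_term : Prop :=
  exists (n : nat) (T : term S 'I_n), 0 < n /\ is_taylor_term T.

Definition is_difference_term (t : term S 'I_3) : Prop :=
  models V (subst (tnth [tuple Var 0; Var 0; Var 1]) t) (Var 1) /\
  forall B : algebra S, V B ->
    forall (alpha : con B) (a b : B), abelian alpha -> alpha a b ->
      eval (tnth [tuple a; b; b]) t = a.

Definition has_difference_term : Prop :=
  exists t : term S 'I_3, is_difference_term t.

Definition commutator_commutative : Prop :=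
  forall A : algebra S, V A -> forall x y : con A,
    con_eq (commutator x y) (commutator y x).

Definition commutator_commutative_comparable : Prop :=
  forall A : algebra S, V A -> forall x y : con A, con_le x y ->
    con_eq (commutator x y) (commutator y x).

End MaltsevConditions.

(* Main.v *)
(* (1) => (2).  If [t] is a difference term, commutativity of the commutator
   follows by applying [t(_, b-row, last entry)] to a matrix.  If there were no
   Taylor term, every idempotent term would have a coordinate behaving like
   that of a projection; colouring the idempotent binary terms accordingly
   gives a quotient of the binary term algebra in [V] in which the generators
   [x], [y] are distinct and congruent modulo an abelian congruence, while
   [t(x, y, y) = y].

   (3) => (1).  A Taylor term makes three entries of a matrix over an abelian
   congruence determine the fourth, so a term [d] with [d(x, x, y) = y] acts on
   abelian blocks by translations.  On the terms in [x], [z], [y], let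
   [theta1 <= theta] be the kernels of the substitutions [z := x] and
   [z, y := x].  Identify terms that are [theta1]-related and whose images
   under all polynomials, when they become [x] for [z := x], differ for
   [z := y] by such a translation.  This is a congruence [eps] with
   [C(theta1, theta; eps)], so by hypothesis [C(theta, theta1; eps)].  Each
   Taylor identity yields a pair [T(.., x, ..), T(.., z, ..)] in [eps], hence
   [(x, z)] is in [eps], and the translation witnessing this is a difference
   term. *)

From Stdlib Require Import RelationClasses FunctionalExtensionality.
From Stdlib Require Import PropExtensionality ProofIrrelevance ClassicalEpsilon.
Require Import Defs.
From mathcomp Require Import all_boot.

Set Implicit Arguments.
Unset Strict Implicit.
Unset Printing Implicit Defensive.

(** * Evaluation, substitution and term algebras *)

Section Evaluation.
Variable S : signature.

Lemma eval_subst (A : algebra S) X Y (s : X -> term S Y) (e : Y -> A) t :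
  eval e (subst s t) = eval (fun x => eval e (s x)) t.
Proof.
elim: t => //= f args IH.
by congr interp; apply: functional_extensionality => i; apply: IH.
Qed.

Lemma eq_eval (A : algebra S) X (e e' : X -> A) t :
  e =1 e' -> eval e t = eval e' t.
Proof. by move=> /functional_extensionality->. Qed.

Lemma eval_con (A : algebra S) (theta : con A) X (e e' : X -> A) t :
  (forall x, theta (e x) (e' x)) -> theta (eval e t) (eval e' t).
Proof. by move=> ee'; elim: t => //= f args IH; apply: con_compat. Qed.

Definition term_algebra (X : Type) (x0 : X) : algebra S :=
  @Algebra S (term S X) (@App S X) (inhabits (Var x0)).

Lemma eval_term_algebra X (x0 : X) Y (e : Y -> term_algebra x0) t :
  eval e t = subst e t.
Proof.
elim: t => //= f args IH.
by congr App; apply: functional_extensionality.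
Qed.

Lemma subst_Var X (t : term S X) : subst (fun x => Var x) t = t.
Proof.
elim: t => //= f args IH.
by congr App; apply: functional_extensionality.
Qed.

End Evaluation.

Arguments term_algebra S {X} x0.

(** * Congruences, matrices and basic properties of the commutator *)

Section Congruence.
Variables (S : signature) (A : algebra S).
Implicit Types theta alpha beta delta eps : con A.

Lemma con_refl theta a : theta a a.
Proof. by have [r _ _] := con_equiv theta; apply: r. Qed.

Lemma con_sym theta a b : theta a b -> theta b a.
Proof. by have [_ s _] := con_equiv theta; apply: s. Qed.

Lemma con_trans theta b a c : theta a b -> theta b c -> theta a c.
Proof. by have [_ _ t] := con_equiv theta; apply: t. Qed.

(* The matrices form the subalgebra of A^4 generated by the constant-row and
   the constant-column matrices; see mxP. *)
Inductive mx (alpha beta : con A) : A -> A -> A -> A -> Prop :=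
| mx_row p r : alpha p r -> mx alpha beta p p r r
| mx_col p q : beta p q -> mx alpha beta p q p q
| mx_op (f : op S) (p q r s : 'I_(arity f) -> A) :
    (forall i, mx alpha beta (p i) (q i) (r i) (s i)) ->
    mx alpha beta (interp p) (interp q) (interp r) (interp s).

Lemma mx_eval alpha beta X (p q r s : X -> A) t :
  (forall x, mx alpha beta (p x) (q x) (r x) (s x)) ->
  mx alpha beta (eval p t) (eval q t) (eval r t) (eval s t).
Proof. by move=> pqrs; elim: t => //= f args IH; apply: mx_op. Qed.

(** At [mx_op] the terms obtained for the arguments must not share variables: their parameters are
    indexed by the dependent sums [I] and [J], then renumbered as ordinals by [enum_rank]. *)
Lemma mxP alpha beta p q r s :
  is_matrix alpha beta p q r s <-> mx alpha beta p q r s.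
Proof.
split.
  move=> [m [n [t [a [b [u [v [ab uv [-> ->] [-> ->]]]]]]]]].
  by apply: mx_eval => -[i|j] /=; [apply: mx_row|apply: mx_col].
elim=> {p q r s} [p r pr|p q pq|f p q r s _].
- exists 1%N, 0%N, (Var (inl ord0)), (fun=> p), (fun=> r), (fun=> p), (fun=> p).
  by split=> //= -[].
- exists 0%N, 1%N, (Var (inr ord0)), (fun=> p), (fun=> p), (fun=> p), (fun=> q).
  by split=> //= -[].
move=> /fin_all_exists [m] /fin_all_exists [n] /fin_all_exists [t].
move=> /fin_all_exists [a] /fin_all_exists [b] /fin_all_exists [u].
move=> /fin_all_exists [v] H.
pose I : finType := {i : 'I_(arity f) & 'I_(m i)}.
pose J : finType := {i : 'I_(arity f) & 'I_(n i)}.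
pose var i (x : 'I_(m i) + 'I_(n i)) : term S ('I_#|I| + 'I_#|J|) :=
  match x with
  | inl k => Var (inl (enum_rank (Tagged (fun i => 'I_(m i)) k)))
  | inr k => Var (inr (enum_rank (Tagged (fun i => 'I_(n i)) k)))
  end.
pose fI (a : forall i, 'I_(m i) -> A) (k : 'I_#|I|) :=
  let x : I := enum_val k in a (tag x) (tagged x).
pose fJ (a : forall i, 'I_(n i) -> A) (k : 'I_#|J|) :=
  let x : J := enum_val k in a (tag x) (tagged x).
exists #|I|, #|J|, (@App S _ f (fun i => subst (@var i) (t i))), (fI a), (fI b), (fJ u), (fJ v).
have E a' u' i : eval (join_env (fI a') (fJ u')) (subst (@var i) (t i))
                 = eval (join_env (a' i) (u' i)) (t i).
  rewrite eval_subst; apply: eq_eval => -[k|k] /=; rewrite /fI /fJ enum_rankK //=.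
split.
- by move=> k; have [ab _ _ _] := H (tag (enum_val k)); apply: ab.
- by move=> k; have [_ uv _ _] := H (tag (enum_val k)); apply: uv.
- split; congr interp; apply: functional_extensionality => i;
  have [_ _ [Hp Hq] _] := H i; first exact: etrans Hp (esym (E _ _ _)).
  exact: etrans Hq (esym (E _ _ _)).
- split; congr interp; apply: functional_extensionality => i;
  have [_ _ _ [Hr Hs]] := H i; first exact: etrans Hr (esym (E _ _ _)).
  exact: etrans Hs (esym (E _ _ _)).
Qed.

Lemma mx_trans alpha beta p q r s :
  mx alpha beta p q r s -> mx beta alpha p r q s.
Proof. by elim=> *; [apply: mx_col|apply: mx_row|apply: mx_op]. Qed.

Lemma mx_swap_rows alpha beta p q r s :
  mx alpha beta p q r s -> mx alpha beta r s p q.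
Proof.
elim=> *; [apply: mx_row; exact: con_sym|exact: mx_col|exact: mx_op].
Qed.

Lemma mx_swap_cols alpha beta p q r s :
  mx alpha beta p q r s -> mx alpha beta q p s r.
Proof. by move=> /mx_trans/mx_swap_rows/mx_trans. Qed.

Lemma mx_rows_rel alpha beta p q r s :
  mx alpha beta p q r s -> beta p q /\ beta r s.
Proof.
elim=> {p q r s} [p r _|p q //|f p q r s _ IH]; first by split; exact: con_refl.
by split; apply: con_compat => i; case: (IH i).
Qed.

Lemma mx_cols_rel alpha beta p q r s :
  mx alpha beta p q r s -> alpha p r /\ alpha q s.
Proof. by move=> /mx_trans/mx_rows_rel. Qed.

Lemma centralizesP alpha beta delta :
  centralizes alpha beta delta <->
  forall p q r s, mx alpha beta p q r s -> delta p q -> delta r s.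
Proof.
split=> C p q r s; first by move=> /mxP; apply: C.
by move=> /mxP; apply: C.
Qed.

Lemma commutator_eq0 alpha beta :
  con_eq (commutator alpha beta) (con0 A) <-> centralizes alpha beta (con0 A).
Proof.
split=> [E p q r s M pq|C a b].
  apply/E; apply: (commutator_centralizes M); exact/E.
split; first exact: (commutator_least C).
by move=> ab; rewrite (ab : a = b); exact: con_refl.
Qed.

Lemma commutator_le_left alpha beta : con_le (commutator alpha beta) alpha.
Proof.
apply: commutator_least; apply/centralizesP => p q r s /mx_cols_rel [pr qs] pq.
exact: con_trans (con_sym pr) (con_trans pq qs).
Qed.

Lemma commutator_le_right alpha beta : con_le (commutator alpha beta) beta.
Proof. by apply: commutator_least; apply/centralizesP => p q r s /mx_rows_rel []. Qed.

End Congruence.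

Lemma mx_hom (S : signature) (A B : algebra S) (h : A -> B)
    (alpha beta : con A) (alpha' beta' : con B) p q r s :
  (forall f (a : 'I_(arity f) -> A), h (interp a) = interp (fun i => h (a i))) ->
  (forall a b, alpha a b -> alpha' (h a) (h b)) ->
  (forall a b, beta a b -> beta' (h a) (h b)) ->
  mx alpha beta p q r s -> mx alpha' beta' (h p) (h q) (h r) (h s).
Proof.
move=> hop ha hb; elim=> {p q r s} [p r /ha|p q /hb|f p q r s _ IH].
- exact: mx_row.
- exact: mx_col.
by rewrite !hop; apply: mx_op.
Qed.

(** * The largest congruence inside an equivalence relation *)

Section SyntacticCongruence.
Variables (S : signature) (A : algebra S).

Inductive polynomial : (A -> A) -> Prop :=
| polynomial_id : polynomial id
| polynomial_op g (f : op S) (i : 'I_(arity f)) (c : 'I_(arity f) -> A) :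
    polynomial g ->
    polynomial (fun w => g (interp (fun j => if j == i then w else c j))).

Variable E : A -> A -> Prop.
Hypothesis E_equiv : Equivalence E.

Definition syn_rel (a b : A) : Prop := forall g, polynomial g -> E (g a) (g b).

Lemma syn_equiv : Equivalence syn_rel.
Proof.
have [r s t] := E_equiv; split.
- by move=> a g _; apply: r.
- by move=> a b ab g /ab; apply: s.
- by move=> a b c ab bc g Pg; apply: t (ab g Pg) (bc g Pg).
Qed.

Lemma syn_compat (f : op S) (a b : 'I_(arity f) -> A) :
  (forall i, syn_rel (a i) (b i)) -> syn_rel (interp a) (interp b).
Proof.
move=> ab; have [r _ t] := syn_equiv.
(* The arguments are exchanged one at a time, since a polynomial tests a single place. *)
pose c k (j : 'I_(arity f)) := if j < k then b j else a j.
suff H k : k <= arity f -> syn_rel (interp a) (interp (c k)).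
  have := H _ (leqnn _); congr syn_rel; congr interp.
  by apply: functional_extensionality => j; rewrite /c ltn_ord.
elim: k => [_|k IH lt_k].
  rewrite (_ : c 0 = a); first exact: r.
  by apply: functional_extensionality.
apply: t (IH (ltnW lt_k)) _; pose i := Ordinal lt_k.
have Ek (d : 'I_(arity f) -> A) : d = fun j => if j == i then d i else d j.
  by apply: functional_extensionality => j; case: eqP => // ->.
rewrite (Ek (c k)) (Ek (c k.+1)) {1}/c {2}/c /= ltnn ltnS leqnn.
rewrite (_ : (fun j => if j == i then b i else c k.+1 j) =
             (fun j => if j == i then b i else c k j)); last first.
  apply: functional_extensionality => j; case: eqP => // /eqP ji.
  by rewrite /c ltnS leq_eqVlt; case: (eqVneq (j : nat) k) ji => // jk /eqP[]; apply: val_inj.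
by move=> g Pg; apply: (ab i) (polynomial_op i (c k) Pg).
Qed.

Definition syn : con A := Con syn_equiv syn_compat.

Lemma syn_le a b : syn a b -> E a b.
Proof. by apply; apply: polynomial_id. Qed.

Lemma polynomial_con (theta : con A) g a b :
  polynomial g -> theta a b -> theta (g a) (g b).
Proof.
move=> Pg; elim: Pg a b => //= {}g f i c _ IH a b ab.
apply: IH; apply: con_compat => j; case: eqP => // _; exact: con_refl.
Qed.

Lemma le_syn (theta : con A) :
  (forall a b, theta a b -> E a b) -> con_le theta syn.
Proof. by move=> leE a b ab g Pg; apply/leE/polynomial_con. Qed.

Lemma mx_polynomial (alpha beta : con A) g p q r s : polynomial g ->
  mx alpha beta p q r s -> mx alpha beta (g p) (g q) (g r) (g s).
Proof.
move=> Pg; elim: Pg p q r s => //= {}g f i c _ IH p q r s M.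
apply: IH; apply: mx_op => j; case: eqP => // _.
by apply: mx_row; apply: con_refl.
Qed.

(** Matrices are closed under unary polynomials, so the implication for [E] passes to [syn]. *)
Lemma syn_centralizes (alpha beta : con A) :
  (forall p q r s, mx alpha beta p q r s -> E p q -> E r s) ->
  centralizes alpha beta syn.
Proof.
move=> H; apply/centralizesP => p q r s M pq g Pg.
exact: H (mx_polynomial Pg M) (pq g Pg).
Qed.

End SyntacticCongruence.

(** * Quotient algebras *)

Section Quotient.
Variables (S : signature) (A : algebra S) (eps : con A).

(** Related elements have extensionally equal classes, so [epsilon] picks the same element for both;
    the fixed points of [rep] can then serve as the carrier of the quotient. *)
Definition rep (a : A) : A := epsilon (inhabits a) (eps a).

Lemma rep_con a : eps a (rep a).
Proof. by apply: (epsilon_spec (inhabits a)); exists a; apply: con_refl. Qed.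

Lemma rep_eq a b : eps a b -> rep a = rep b.
Proof.
move=> ab; rewrite /rep.
have -> : eps a = eps b.
  apply: functional_extensionality => c; apply: propositional_extensionality.
  by split; apply: con_trans => //; apply: con_sym.
by congr epsilon; apply: proof_irrelevance.
Qed.

Lemma rep_idem a : rep (rep a) = rep a.
Proof. by apply/esym/rep_eq/rep_con. Qed.

Definition quot_class (a : A) : {a : A | rep a = a} := exist _ (rep a) (rep_idem a).

Lemma quot_inhabited : inhabited {a : A | rep a = a}.
Proof. by case: (carrier_inhabited A) => a; split; apply: quot_class a. Qed.

Definition quot : algebra S :=
  @Algebra S {a : A | rep a = a}
    (fun f a => quot_class (interp (fun i => proj1_sig (a i)))) quot_inhabited.

Definition pi : A -> quot := quot_class.
Definition lift_quot (x : quot) : A := proj1_sig x.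

Lemma pi_eq a b : pi a = pi b <-> eps a b.
Proof.
split=> [[ab]|ab].
  by apply: con_trans (rep_con a) _; rewrite ab; apply: con_sym; apply: rep_con.
by apply: eq_sig_hprop => [? ? ?|]; [apply: proof_irrelevance|exact: rep_eq].
Qed.

Lemma lift_quotK : cancel lift_quot pi.
Proof.
by move=> [a ra]; apply: eq_sig_hprop => // ? ? ?; apply: proof_irrelevance.
Qed.

Lemma lift_pi a : eps a (lift_quot (pi a)).
Proof. exact: rep_con. Qed.

Lemma pi_interp f (a : 'I_(arity f) -> A) :
  pi (interp a) = interp (fun i => pi (a i)).
Proof. by apply/pi_eq; apply: con_compat => i; apply: lift_pi. Qed.

Lemma eval_pi X (e : X -> A) t : eval (fun x => pi (e x)) t = pi (eval e t).
Proof.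
elim: t => //= f args IH; rewrite pi_interp.
by congr (@interp S quot); apply: functional_extensionality.
Qed.

Lemma eval_quot X (e : X -> quot) t :
  eval e t = pi (eval (fun x => lift_quot (e x)) t).
Proof. by rewrite -eval_pi; apply: eq_eval => x; rewrite lift_quotK. Qed.

(** This places quotients of plain term algebras in [V]. *)
Lemma quot_variety (V : algebra S -> Prop) : is_variety V ->
  (forall (p q : term S nat), models V p q ->
     forall e : nat -> A, eps (eval e p) (eval e q)) ->
  V quot.
Proof.
move=> [E VE] H; apply/VE => p q Epq e; rewrite !eval_quot; apply/pi_eq/H.
by move=> B /VE/(_ _ _ Epq).
Qed.

Section QuotientCongruence.
Variable theta : con A.
Hypothesis le_theta : con_le eps theta.

Lemma quot_con_equiv :
  Equivalence (fun x y : quot => theta (lift_quot x) (lift_quot y)).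
Proof.
split=> [x|x y|x y z]; [exact: con_refl|exact: con_sym|exact: con_trans].
Qed.

Lemma quot_con_compat f (a b : 'I_(arity f) -> quot) :
  (forall i, theta (lift_quot (a i)) (lift_quot (b i))) ->
  theta (lift_quot (interp a)) (lift_quot (interp b)).
Proof.
move=> ab; apply: (con_trans (con_sym (le_theta (lift_pi _)))).
apply: con_trans (le_theta (lift_pi _)); exact: con_compat.
Qed.

Definition quot_con : con quot := Con quot_con_equiv quot_con_compat.

Lemma quot_con_pi a b : theta a b -> quot_con (pi a) (pi b).
Proof.
move=> ab; apply: (con_trans (con_sym (le_theta (lift_pi _)))).
exact: con_trans (le_theta (lift_pi _)).
Qed.

End QuotientCongruence.

(** A matrix of the quotient is the image of the matrix with the same term and lifted parameters. *)
Lemma quot_centralizes alpha beta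
    (le_alpha : con_le eps alpha) (le_beta : con_le eps beta) :
  centralizes (quot_con le_alpha) (quot_con le_beta) (con0 quot) <->
  centralizes alpha beta eps.
Proof.
split=> C.
  apply/centralizesP => p q r s M /pi_eq pq; apply/pi_eq.
  move/centralizesP: C => /(_ (pi p) (pi q)); apply=> //.
  apply: mx_hom M => [f a|a b|a b]; [exact: pi_interp|exact: quot_con_pi..].
move=> _ _ _ _ [m [n [t [a [b [u [v [ab uv [-> ->] [-> ->]]]]]]]]].
rewrite /= !eval_quot => /pi_eq pq; apply/pi_eq; move: pq.
move/centralizesP: C; apply; apply: mx_eval => -[i|j] /=.
  by apply: mx_row; apply: ab.
by apply: mx_col; apply: uv.
Qed.

End Quotient.

Lemma env3_comp (X Y : Type) (g : X -> Y) (a b c : X) j :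
  g (tnth [tuple a; b; c] j) = tnth [tuple g a; g b; g c] j.
Proof. by case: j => -[|[|[]]]. Qed.

Lemma env3_const (X : Type) (a : X) : tnth [tuple a; a; a] = fun=> a.
Proof. by apply: functional_extensionality => -[[|[|[]]]]. Qed.

(** * A difference term makes the commutator commutative *)

Section DifferenceTerm.
Variables (S : signature) (V : algebra S -> Prop) (t : term S 'I_3).
Hypotheses (hV : is_variety V) (ht : is_difference_term V t).

Lemma difference_term_left (A : algebra S) (a b : A) :
  V A -> eval (tnth [tuple a; a; b]) t = b.
Proof.
move=> VA; have [/(_ A VA (fun n => if n is 0 then a else b)) + _] := ht.
rewrite eval_subst /= => E; rewrite -[RHS]E.
by apply: eq_eval => j; rewrite (env3_comp (eval _)).
Qed.

Lemma quot_in_variety (A : algebra S) (eps : con A) : V A -> V (quot eps).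
Proof. by move=> VA; apply: quot_variety => // p q pq e; rewrite (pq A VA e); apply: con_refl. Qed.

(** Modulo [[theta, theta]] the congruence [theta] becomes abelian, and the quotient is still in
    [V]. *)
Lemma difference_term_right (A : algebra S) (theta : con A) (a b : A) :
  V A -> theta a b ->
  commutator theta theta (eval (tnth [tuple a; b; b]) t) a.
Proof.
move=> VA ab; have le_theta := @commutator_le_left _ _ theta theta.
apply/pi_eq; rewrite -eval_pi.
have [_ /(_ _ (quot_in_variety (commutator theta theta) VA) (quot_con le_theta))] := ht.
move=> /(_ (pi _ a) (pi _ b)) <-.
- by apply: eq_eval => j; rewrite (env3_comp (pi _)).
- by apply/commutator_eq0/quot_centralizes/commutator_centralizes.
- exact: quot_con_pi.
Qed.

End DifferenceTerm.

Section Meet.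
Variables (S : signature) (A : algebra S) (alpha beta : con A).

Lemma con_meet_equiv : Equivalence (fun a b => alpha a b /\ beta a b).
Proof.
split=> [a|a b []|a b c [ab ab'] [bc bc']]; first by split; apply: con_refl.
  by split; apply: con_sym.
by split; [apply: con_trans ab bc|apply: con_trans ab' bc'].
Qed.

Lemma con_meet_compat (f : op S) (a b : 'I_(arity f) -> A) :
  (forall i, alpha (a i) (b i) /\ beta (a i) (b i)) ->
  alpha (interp a) (interp b) /\ beta (interp a) (interp b).
Proof. by move=> ab; split; apply: con_compat => i; case: (ab i). Qed.

Definition con_meet : con A := Con con_meet_equiv con_meet_compat.

Lemma commutator_meet_le :
  con_le (commutator con_meet con_meet) (commutator alpha beta).
Proof.
apply: commutator_least; apply/centralizesP => p q r s M.
move/centralizesP: (@commutator_centralizes _ _ alpha beta); apply.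
by apply: (mx_hom (h := id)) M => // a b [].
Qed.

End Meet.

Lemma difference_term_commutative (S : signature) (V : algebra S -> Prop) :
  is_variety V -> has_difference_term V -> commutator_commutative V.
Proof.
move=> hV [t ht] A VA.
suff le (x y : con A) : con_le (commutator y x) (commutator x y).
  by move=> x y a b; split; apply: le.
apply: commutator_least; apply/centralizesP => p q r s M pq.
have [yr ys] := mx_cols_rel M; have [xp xr] := mx_rows_rel M.
have /centralizesP C := @commutator_centralizes _ _ x y.
pose d (a b c : A) := eval (tnth [tuple a; b; c]) t.
(* Feeding the matrix [p r; q s] to [d(_, second row, last entry)] yields
   [d p q s, d r s s; s, s], where [d p q s] is congruent to [s], and
   [d r s s] to [r]. *)
have M' : mx x y (d p q s) (d r s s) (d q q s) (d s s s).
  apply: mx_eval => -[[|[|[|//]]] ?] /=.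
  - exact: mx_trans M.
  - apply: mx_col. exact: ys.
  - by apply: mx_row; apply: con_refl.
have dq (a : A) : d a a s = s.
  exact: (difference_term_left ht).
have H1 := C _ _ _ _ (mx_swap_rows M').
rewrite !dq in H1; have {}H1 := H1 (con_refl _ _).
(* The pair [(r, s)] is in [x] as a row of [M], and in [y] along [r], [p], [q], [s]. *)
have H2 : commutator x y (d r s s) r.
  apply/commutator_meet_le/(difference_term_right hV ht VA); split=> //.
  apply: con_trans (con_sym yr) (con_trans _ ys).
  exact: commutator_le_right pq.
have H3 : commutator x y (d p q s) (d q q s).
  apply: eval_con => -[[|[|[|//]]] ?] //; exact: (con_refl (commutator x y)).
rewrite dq in H3.
exact: con_trans (con_sym H2) (con_trans (con_sym H1) H3).
Qed.

(** * A difference term yields a Taylor term: dictators and colourings *)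

Section EquationCongruence.
Variables (S : signature) (V : algebra S -> Prop) (X : Type) (x0 : X).
Variable P : forall A : algebra S, (X -> A) -> Prop.

(** All assignments give the identities of [V]; constant ones give the kernel of identifying all
    variables. *)
Definition eq_rel (p q : term_algebra S x0) : Prop :=
  forall A : algebra S, V A -> forall e : X -> A, P e -> eval e p = eval e q.

Lemma eq_rel_equiv : Equivalence eq_rel.
Proof.
split=> [p A VA e Pe|p q pq A VA e Pe|p q r pq qr A VA e Pe] //.
  by rewrite pq.
by rewrite pq ?qr.
Qed.

Lemma eq_rel_compat (f : op S) (a b : 'I_(arity f) -> term_algebra S x0) :
  (forall i, eq_rel (a i) (b i)) -> eq_rel (interp a) (interp b).
Proof.
move=> ab A VA e Pe /=; congr interp.
by apply: functional_extensionality => i; apply: ab.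
Qed.

Definition eq_con : con (term_algebra S x0) := Con eq_rel_equiv eq_rel_compat.

End EquationCongruence.

Section IdempotentTerms.
Variables (S : signature) (V : algebra S -> Prop).

Definition idempotent X (t : term S X) : Prop :=
  forall A : algebra S, V A -> forall a : A, eval (fun=> a) t = a.

Definition minor X Y (t : term S Y) (T : term S X) (w : X -> Y) : Prop :=
  forall A : algebra S, V A ->
  forall e : Y -> A, eval e t = eval (fun x => e (w x)) T.

Lemma minor_trans X Y Z (t : term S Z) (u : term S Y) (T : term S X) w w' :
  minor t u w' -> minor u T w -> minor t T (w' \o w).
Proof. by move=> tu uT A VA e; rewrite tu // uT. Qed.

(* No Taylor identity for the coordinate [i] holds. *)
Definition dictator X (T : term S X) (i : X) : Prop :=
  forall w z : X -> nat,
    (forall A : algebra S, V A -> forall e : nat -> A,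
       eval (fun x => e (w x)) T = eval (fun x => e (z x)) T) ->
    w i = z i.

Lemma dictator_eq X (T : term S X) i (Y : countType) (w z : X -> Y) :
  dictator T i ->
  (forall A : algebra S, V A -> forall e : Y -> A,
     eval (fun x => e (w x)) T = eval (fun x => e (z x)) T) ->
  w i = z i.
Proof.
move=> iT wz; apply: (pcan_inj pickleK).
by apply: (iT (pickle \o w) (pickle \o z)) => A VA e; apply: (wz A VA (e \o pickle)).
Qed.

Lemma dictator_exists (X : finType) (T : term S X) :
  ~ has_taylor_term V -> idempotent T -> exists i, dictator T i.
Proof.
move=> noT idT; apply: NNPP => noi; apply: noT.
(* The dummy variable [None] makes the arity positive even for empty [X]; it has a trivial Taylor
   identity, being ignored by the term. *)
pose OX : finType := option X.
pose v (x : X) : 'I_#|OX| := enum_rank (Some x : OX).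
exists #|OX|, (subst (fun x => Var (v x)) T); split.
  by rewrite card_option.
split=> [A VA e|k]; first by rewrite !eval_subst /= idT.
apply: NNPP => H; case: (enum_val k) (enum_valK k) => [x kx|k0].
  apply: noi; exists x => w z wz; apply: NNPP => wzx; apply: H.
  exists (fun j => oapp w 0 (enum_val j)), (fun j => oapp z 0 (enum_val j)).
  split; first by rewrite -kx enum_rankK.
  move=> A VA e; rewrite !eval_subst /=.
  have := wz A VA e; congr (_ = _); apply: eq_eval => y;
  by rewrite /v enum_rankK.
apply: H; exists (fun j => if enum_val j is Some _ then 0 else 1), (fun=> 0).
split; first by rewrite -k0 enum_rankK.
move=> A VA e; rewrite !eval_subst; apply: eq_eval => y /=.
by rewrite /v enum_rankK.
Qed.

(** A common upper bound: for idempotent [T] and [U], identifying variables along one projection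
    collapses the other factor. *)
Definition star X Y (T : term S X) (U : term S Y) : term S (X * Y) :=
  subst (fun x => subst (fun y => Var (x, y)) U) T.

Lemma eval_star X Y (T : term S X) (U : term S Y) (A : algebra S) e :
  eval e (star T U) = eval (fun x => eval (fun y => e (x, y)) U) T :> A.
Proof. by rewrite eval_subst; apply: eq_eval => x; rewrite eval_subst. Qed.

Lemma idempotent_star X Y (T : term S X) (U : term S Y) :
  idempotent T -> idempotent U -> idempotent (star T U).
Proof.
move=> idT idU A VA a; rewrite eval_star -[RHS](idT A VA a).
by apply: eq_eval => x; apply: idU.
Qed.

Lemma minor_star_l X Y (T : term S X) (U : term S Y) :
  idempotent U -> minor T (star T U) fst.
Proof.
by move=> idU A VA e; rewrite eval_star; apply: eq_eval => x /=; rewrite idU.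
Qed.

Lemma minor_star_r X Y (T : term S X) (U : term S Y) :
  idempotent T -> minor U (star T U) snd.
Proof. by move=> idT A VA e; rewrite eval_star /= idT. Qed.

(* Idempotent terms are directed by [minor] (see [star]); [eventually]
   quantifies over the dictators of all terms above some idempotent term.
   This replaces a compactness argument that would pick a dictator of every
   idempotent term compatibly with minors. *)
Definition eventually (P : forall X : finType, term S X -> X -> Prop) : Prop :=
  exists (X0 : finType) (T0 : term S X0), idempotent T0 /\
    forall (X : finType) (T : term S X) (i : X),
      idempotent T -> dictator T i -> (exists w, minor T0 T w) -> P X T i.

Lemma eventually_and (P Q : forall X : finType, term S X -> X -> Prop) :
  eventually P -> eventually Q -> eventually (fun X T i => P X T i /\ Q X T i).
Proof.
move=> [X [T [idT PT]]] [Y [U [idU QU]]].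
exists (X * Y)%type, (star T U); split; first exact: idempotent_star.
move=> Z W i idW iW [w wW]; split; [apply: PT|apply: QU] => //.
  by exists (fst \o w); apply: minor_trans wW; apply: minor_star_l.
by exists (snd \o w); apply: minor_trans wW; apply: minor_star_r.
Qed.

Lemma eventually_impl (P Q : forall X : finType, term S X -> X -> Prop) :
  (forall (X : finType) (T : term S X) i,
     idempotent T -> dictator T i -> P X T i -> Q X T i) ->
  eventually P -> eventually Q.
Proof.
move=> PQ [X [T [idT PT]]]; exists X, T; split=> // Y U i idU iU TU.
exact/PQ/PT.
Qed.

Lemma eventually_minor (X : finType) (t : term S X) :
  idempotent t -> eventually (fun _ T _ => exists w, minor t T w).
Proof. by move=> idt; exists X, t. Qed.

Lemma eventually_exists (P : forall X : finType, term S X -> X -> Prop) :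
  ~ has_taylor_term V -> eventually P ->
  exists (X : finType) (T : term S X) i,
    [/\ idempotent T, dictator T i & P X T i].
Proof.
move=> noT [X [T [idT PT]]]; have [i iT] := dictator_exists noT idT.
exists X, T, i; split=> //; apply: PT => //.
by exists id.
Qed.

(* When [T] is read as the projection to its dictator [i], its minor [u] becomes
   the projection to the variable [b]. *)
Definition colour (X : finType) (T : term S X) (i : X) (u : term S bool) b :=
  exists2 w, minor u T w & w i = b.

Lemma colour_inj (X : finType) (T : term S X) i u b c :
  dictator T i -> colour T i u b -> colour T i u c -> b = c.
Proof.
move=> iT [w uw <-] [z uz <-]; apply: dictator_eq iT _ => A VA e.
by rewrite -uw ?uz.
Qed.

Definition same_colour (u v : term S bool) : Prop :=
  eventually (fun X T i => exists2 b, colour T i u b & colour T i v b).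

(** The first conjunct transfers idempotence from [u] to [v], which makes the second one
    symmetric. *)
Definition colour_rel (u v : term_algebra S true) : Prop :=
  eq_con V true (fun A e => exists a, e = fun=> a) u v /\
  (idempotent u -> same_colour u v).

Lemma idempotent_eq (u v : term_algebra S true) :
  eq_con V true (fun A e => exists a, e = fun=> a) u v ->
  idempotent u -> idempotent v.
Proof. by move=> uv idu A VA a; rewrite -uv ?idu //; exists a. Qed.

Lemma colour_rel_equiv : Equivalence colour_rel.
Proof.
split=> [u|u v [uv cuv]|u v w [uv cuv] [vw cvw]].
- split; [exact: con_refl|move=> idu].
  apply: eventually_impl (eventually_minor idu) => X T i _ _ [w uw].
  by exists (w i); exists w.
- split; [exact: con_sym|move=> idv].
  have {cuv} := cuv (idempotent_eq (con_sym uv) idv).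
  by apply: eventually_impl => X T i _ _ [b ub vb]; exists b.
split; [exact: con_trans uv vw|move=> idu].
have := eventually_and (cuv idu) (cvw (idempotent_eq uv idu)).
apply: eventually_impl => X T i _ iT [[b ub vb] [c vc wc]].
by exists b => //; rewrite (colour_inj iT vb vc).
Qed.

(** With the blocks kept apart, the image of a dictator names both an argument [k] of [t] and a
    colour. *)
Definition spread K (e : K -> term S bool) (t : term S K) : term S (K * bool) :=
  subst (fun k => subst (fun b => Var (k, b)) (e k)) t.

Lemma eval_spread K (e : K -> term S bool) t (A : algebra S) (f : K * bool -> A) :
  eval f (spread e t) = eval (fun k => eval (fun b => f (k, b)) (e k)) t.
Proof. by rewrite eval_subst; apply: eq_eval => k; rewrite eval_subst. Qed.

Lemma minor_spread K (e : K -> term S bool) t : minor (subst e t) (spread e t) snd.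
Proof. by move=> A VA f; rewrite eval_spread eval_subst. Qed.

Lemma idempotent_spread K (e : K -> term S bool) t :
  idempotent (subst e t) -> idempotent (spread e t).
Proof. by move=> idt A VA a; rewrite eval_spread -eval_subst idt. Qed.

(* Collapsing all variables outside block [k] identifies the two spreads. *)
Lemma spread_agree (K : finType) (e e' : K -> term S bool) t
    (X : finType) (T : term S X) i w w' kb :
  dictator T i -> minor (spread e t) T w -> minor (spread e' t) T w' ->
  (forall k, eq_con V true (fun A e => exists a, e = fun=> a) (e k) (e' k)) ->
  w i = kb -> e kb.1 = e' kb.1 -> w' i = kb.
Proof.
case: kb => k b iT ew ew' ee' wi /= ek.
pose g (x : K * bool) := if x.1 == k then Some x.2 else None.
suff : g (w i) = g (w' i).
  by rewrite /g wi /= eqxx; case: (w' i) => k' b' /=; case: eqP => // -> [->].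
apply: (dictator_eq (w := g \o w) (z := g \o w')) iT _ => A VA f /=.
rewrite -(ew A VA (f \o g)) -(ew' A VA (f \o g)) !eval_spread.
apply: eq_eval => k'; rewrite /g /=; case: eqP => [->|_]; first by rewrite ek.
by apply: ee' => //; exists (f None).
Qed.

(** Follow the dictator into the blocks of the four spreads. If [r] or [s] reads a block of the
    first group, where both have the same argument, they read the same variable. Otherwise [r] reads
    a block shared with [p], and [s] one shared with [q], and [p], [q] have equal colours. *)
Lemma colour_rel_matrix p q r s :
  let alpha := eq_con V true (fun A e => exists a, e = fun=> a) in
  mx alpha alpha p q r s -> colour_rel p q -> colour_rel r s.
Proof.
move=> alpha M [_ cpq]; have [pq rs] := mx_rows_rel M.
have [pr _] := mx_cols_rel M; split=> // idr.
have idp := idempotent_eq (con_sym pr) idr.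
have idq := idempotent_eq pq idp; have ids := idempotent_eq rs idr.
have {}cpq := cpq idp; clear pq rs pr.
move/mxP: M => [m [n [t [a [b [u [v [ab uv [Ep Eq] [Er Es]]]]]]]]].
rewrite !eval_term_algebra in Ep Eq Er Es; subst p q r s.
have ev e idt := eventually_minor (@idempotent_spread _ e t idt).
have := eventually_and cpq (eventually_and (eventually_and (ev _ idp) (ev _ idq))
  (eventually_and (ev _ idr) (ev _ ids))).
apply: eventually_impl => X T i _ iT [[c [w0 pw0 w0c] [w1 qw1 w1c]]].
move=> [[[wp pwp] [wq qwq]] [[wr rwr] [ws sws]]].
have sub e w : minor (spread e t) T w -> minor (subst e t) T (snd \o w).
  by apply: minor_trans; apply: minor_spread.
have cp : (wp i).2 = c.
  by apply: (colour_inj iT _ (ex_intro2 _ _ w0 pw0 w0c)); exists (snd \o wp); [apply: sub|].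
have cq : (wq i).2 = c.
  by apply: (colour_inj iT _ (ex_intro2 _ _ w1 qw1 w1c)); exists (snd \o wq); [apply: sub|].
have ra : forall k : 'I_m + 'I_n, alpha (join_env b u k) (join_env a u k).
  move=> [k|k]; [exact: (con_sym (ab k))|exact: (con_refl alpha)].
have sa : forall k : 'I_m + 'I_n, alpha (join_env b v k) (join_env a v k).
  move=> [k|k]; [exact: (con_sym (ab k))|exact: (con_refl alpha)].
have rsa : forall k : 'I_m + 'I_n, alpha (join_env b u k) (join_env b v k).
  move=> [k|k]; [exact: (con_refl alpha)|exact: (uv k)].
suff rs : (wr i).2 = (ws i).2.
  exists (wr i).2; first by exists (snd \o wr); [apply: sub|].
  by rewrite rs; exists (snd \o ws); [apply: sub|].
case Ei: (wr i) => [[k|k] x].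
  by rewrite (spread_agree iT rwr sws rsa Ei erefl).
case Ej: (ws i) => [[l|l] y].
  rewrite (spread_agree iT sws rwr (fun k => con_sym (rsa k)) Ej erefl) in Ei.
  by case: Ei.
rewrite (spread_agree iT rwr pwp ra Ei erefl) in cp.
rewrite (spread_agree iT sws qwq sa Ej erefl) in cq.
by rewrite /= in cp cq *; rewrite cp cq.
Qed.

End IdempotentTerms.

Lemma difference_term_taylor (S : signature) (V : algebra S -> Prop) :
  is_variety V -> has_difference_term V -> has_taylor_term V.
Proof.
move=> hV [t ht]; apply: NNPP => noT.
pose alpha := eq_con V true (fun A e => exists a, e = fun=> a).
pose eps := syn (colour_rel_equiv V).
have le_alpha : con_le eps alpha by move=> u v /syn_le [].
have Vq : V (quot eps).
  apply: quot_variety => // p q pq e.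
  apply: (@le_syn _ _ _ _ (eq_con V true (fun A e => True))) => [u v uv|A VA f _].
    split=> [A VA f _|idu]; first exact: uv.
    have [_ _ tr] := colour_rel_equiv V.
    apply: eventually_impl (eventually_minor idu) => X T i _ _ [w uw].
    by exists (w i); exists w => // A VA f; rewrite -uw // uv.
  by rewrite !eval_term_algebra !eval_subst pq.
have C : centralizes alpha alpha eps.
  by apply: syn_centralizes => p q r s; apply: colour_rel_matrix.
have dl := difference_term_left ht.
have idt : idempotent V t by move=> A VA a; rewrite -env3_const dl.
pose x : term_algebra S true := Var true; pose y : term_algebra S true := Var false.
have /syn_le[_] : eps (eval (tnth [tuple x; y; y]) t) x.
  apply/pi_eq; rewrite -eval_pi.
  rewrite -[RHS](ht.2 _ Vq (quot_con le_alpha) (pi eps x) (pi eps y)).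
  - by apply: eq_eval => j; rewrite (env3_comp (pi _)).
  - exact/commutator_eq0/quot_centralizes.
  - by apply: quot_con_pi => A VA e [a ->].
rewrite eval_term_algebra => cxy.
have idxy : idempotent V (subst (tnth [tuple x; y; y]) t).
  move=> A VA a; rewrite eval_subst -[RHS](idt A VA a).
  by apply: eq_eval => -[[|[|[]]]].
have ev := eventually_and (cxy idxy) (eventually_minor idt).
have [X [T [i [idT iT [[c [w xyw wc] [z xz zc]] [u tu]]]]]] := eventually_exists noT ev.
have ui : u i = ord_max.
  (* [t(x, x, y) = y] forces the third coordinate. *)
  apply/eqP; apply: (dictator_eq (w := fun k => u k == ord_max) (z := fun=> true)) iT _.
  move=> A VA e; rewrite idT // -[RHS](dl A (e false) _ VA).
  rewrite -(tu A VA (fun j => e (j == ord_max))).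
  by apply: eq_eval => -[[|[|[]]]].
(* The third entry of [t(x, y, y)] has colour [false], while [x] has colour [true]. *)
have wi : w i = tnth [tuple true; false; false] (u i).
  apply: (dictator_eq (z := fun k => tnth [tuple true; false; false] (u k))) iT _.
  move=> A VA e; rewrite -xyw // eval_subst.
  rewrite -(tu A VA (fun j => e (tnth [tuple true; false; false] j))).
  by apply: eq_eval => -[[|[|[]]]].
have zi : z i = true.
  apply: (dictator_eq (z := fun=> true)) iT _ => A VA e.
  by rewrite -xz // idT.
by move: wi; rewrite wc -zc zi ui.
Qed.

(** * Taylor terms and abelian congruences *)

Section TaylorCancellation.
Variables (S : signature) (n : nat) (T : term S 'I_n).

Definition upd (X : Type) (c : 'I_n -> X) (i : 'I_n) (x : X) (j : 'I_n) : X :=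
  if j == i then x else c j.

(** Turn the [x]s into [z]s one coordinate at a time; centrality moves the other entries from [c] to
    the current tuple [d k]. *)
Lemma taylor_cancel (A : algebra S) (theta theta' eps : con A) (x z : A) :
  centralizes theta theta' eps -> theta x z -> theta' x z ->
  (forall i, exists2 c, forall j, theta (c j) x &
     eps (eval (upd c i x) T) (eval (upd c i z) T)) ->
  eps (eval (fun=> x) T) (eval (fun=> z) T).
Proof.
move=> /centralizesP C xz xz' H.
pose d k (j : 'I_n) := if j < k then z else x.
suff D k : k <= n -> eps (eval (d 0) T) (eval (d k) T).
  suff <- : eval (d n) T = eval (fun=> z) T by exact: D.
  by apply: eq_eval => j; rewrite /d ltn_ord.
elim: k => [_|k IH lt_kn]; first exact: con_refl.
apply: con_trans (IH (ltnW lt_kn)) _; pose i := Ordinal lt_kn.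
have [c cx Hc] := H i.
have -> : eval (d k) T = eval (upd (d k) i x) T.
  by apply: eq_eval => j; rewrite /upd /d; case: eqP => // ->; rewrite ltnn.
have -> : eval (d k.+1) T = eval (upd (d k) i z) T.
  apply: eq_eval => j; rewrite /upd /d ltnS leq_eqVlt.
  by rewrite -[j == i]/(nat_of_ord j == k); case: eqP.
apply: C Hc; apply: mx_eval => j; rewrite /upd; case: eqP => _; first exact: mx_col.
apply: mx_row; rewrite /d; case: ifP => _ //.
exact: con_trans xz.
Qed.

End TaylorCancellation.

Section TaylorVariety.
Variables (S : signature) (V : algebra S -> Prop) (n : nat) (T : term S 'I_n).
Hypothesis hT : is_taylor_term V T.

Lemma taylor_idempotent : idempotent V T.
Proof.
by move=> A VA a; have [/(_ A VA (fun=> a)) + _] := hT; rewrite eval_subst.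
Qed.

(** Keep the variable [w i] and identify all others. *)
Lemma taylor_bool i : exists w z : 'I_n -> bool,
  [/\ w i = true, z i = false &
   forall A, V A -> forall x y : A,
     eval (fun j => if w j then x else y) T = eval (fun j => if z j then x else y) T].
Proof.
have [_ /(_ i) [w [z [wz H]]]] := hT.
exists (fun j => w j == w i), (fun j => z j == w i); split=> [||A VA x y].
- exact: eqxx.
- by apply/eqP => /esym.
have := H A VA (fun k => if k == w i then x else y).
by rewrite !eval_subst.
Qed.

Section AbelianCongruence.
Variables (B : algebra S) (beta : con B).
Hypotheses (VB : V B) (betaC : centralizes beta beta (con0 B)).

(* Start from the Taylor identity evaluated on the row [r, s], and move the
   [i]-th entry to the row [p, q]: then [p] occurs on one side only. *)
Lemma matrix_entry_unique p p' q r s :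
  mx beta beta p q r s -> mx beta beta p' q r s -> p = p'.
Proof.
have key w z i p0 : w i = true -> z i = false ->
    eval (fun j => if w j then r else s) T = eval (fun j => if z j then r else s) T ->
    mx beta beta p0 q r s ->
    eval (upd (fun j => if w j then r else s) i p0) T =
    eval (upd (fun j => if z j then r else s) i q) T.
  move=> wi zi wz M; move/centralizesP: betaC; apply; last exact: wz.
  apply: mx_eval => j; rewrite /upd; case: eqP => [->|_].
    by rewrite wi zi; apply: mx_swap_rows.
  have rs : beta r s by have [] := mx_rows_rel M.
  apply: mx_col; case: (w j); case: (z j) => //; [exact: con_refl|exact: con_sym|exact: con_refl].
move=> M M'; have [pq rs] := mx_rows_rel M; have [p'q _] := mx_rows_rel M'.
have [pr _] := mx_cols_rel M.
have pp' : beta p p' by apply: con_trans pq (con_sym p'q).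
rewrite -(taylor_idempotent VB p) -(taylor_idempotent VB p').
apply: (taylor_cancel betaC pp' pp') => i.
have [w [z [wi zi wz]]] := taylor_bool i.
exists (fun j => if w j then r else s).
  move=> j; case: (w j); first exact: con_sym.
  by apply: con_sym; apply: con_trans pr rs.
by rewrite /= (key w z) ?(key w z i p') //; apply: wz.
Qed.

Variables (d : term S 'I_3).
Hypothesis d_left : forall a b : B, eval (tnth [tuple a; a; b]) d = b.

(** Applying [d] gives a second matrix with the entries [p], [q], [r]; its fourth entry must be
    [s]. *)
Lemma translation_matrix p q r s a b : beta a b ->
  mx beta beta p q r s -> q = eval (tnth [tuple a; b; p]) d ->
  s = eval (tnth [tuple a; b; r]) d.
Proof.
move=> ab M Eq.
have M' : mx beta beta (eval (tnth [tuple b; b; p]) d) (eval (tnth [tuple a; b; p]) d)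
                       (eval (tnth [tuple b; b; r]) d) (eval (tnth [tuple a; b; r]) d).
  have [pr _] := mx_cols_rel M.
  apply: mx_eval => -[[|[|[|//]]] ?]; [apply: mx_col|apply: mx_row|exact: mx_row].
    exact: con_sym.
  exact: con_refl.
rewrite !d_left -Eq in M'.
have flip p0 q0 r0 s0 (N : mx beta beta p0 q0 r0 s0) :=
  mx_swap_cols (mx_swap_rows N).
exact: matrix_entry_unique (flip _ _ _ _ M) (flip _ _ _ _ M').
Qed.

(** The matrices [M1] and [M2] differ at most in the first entry, [p] against [d(b, a, q)]. *)
Lemma translation_inverse a b p : beta a b ->
  eval (tnth [tuple b; a; eval (tnth [tuple a; b; p]) d]) d = p.
Proof.
move=> ab; set q := eval (tnth [tuple a; b; p]) d.
pose D (x y z : B) := eval (tnth [tuple x; y; z]) d.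
have pq : beta p q.
  rewrite -[p in beta p](d_left b p).
  apply: eval_con => -[[|[|[|//]]] ?]; [exact: con_sym|exact: con_refl..].
have M1 : mx beta beta (D a a p) (D a b p) (D b a p) (D b b p).
  apply: mx_eval => -[[|[|[|//]]] ?]; [exact: mx_row|exact: mx_col|].
  exact/mx_row/con_refl.
have M2 : mx beta beta (D b a q) (D a a q) (D b a p) (D a a p).
  apply: mx_eval => -[[|[|[|//]]] ?]; [|exact/mx_row/con_refl|].
    exact/mx_col/con_sym.
  exact/mx_row/con_sym.
rewrite /D !d_left -/q in M1 M2.
exact: matrix_entry_unique M2 M1.
Qed.

End AbelianCongruence.

(** * Comparable commutativity yields a difference term *)

Let x : term S 'I_3 := Var ord0.
Let z : term S 'I_3 := Var (lift ord0 ord0).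
Let y : term S 'I_3 := Var ord_max.
Notation Tm3 := (term_algebra S (ord0 : 'I_3)).

(** The variables are ordered [x], [z], [y]; [ker_xxy] and [ker_xxx] are the [theta1] and [theta] of
    the overview. *)
Definition ker_xxy : con Tm3 :=
  eq_con V ord0 (fun A e => exists a b, e = tnth [tuple a; a; b]).
Definition ker_xxx : con Tm3 := eq_con V ord0 (fun A e => exists a, e = fun=> a).

Definition projects_xxy (p : Tm3) : Prop :=
  forall A, V A -> forall a b : A, eval (tnth [tuple a; a; b]) p = a.

Definition left_maltsev (d : term S 'I_3) : Prop :=
  forall A, V A -> forall a b : A, eval (tnth [tuple a; a; b]) d = b.

(* In an abelian block, [d] acts as a translation [w |-> w + d(a, b, b) - b];
   [translation_rel] is equality up to the translations by left Maltsev terms. *)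
Definition translates (d : term S 'I_3) (p q : Tm3) : Prop :=
  forall (B : algebra S) (beta : con B), V B -> centralizes beta beta (con0 B) ->
  forall a b : B, beta a b ->
  eval (tnth [tuple a; b; b]) q =
  eval (tnth [tuple a; b; eval (tnth [tuple a; b; b]) p]) d.

Definition translation_rel (p q : Tm3) : Prop :=
  ker_xxy p q /\
  (projects_xxy p -> exists2 d, left_maltsev d & translates d p q).

Lemma projects_eq (p q : Tm3) : ker_xxy p q -> projects_xxy p -> projects_xxy q.
Proof. by move=> pq Pp A VA a b; rewrite -pq ?Pp //; exists a, b. Qed.

Lemma ker_xxy_le_xxx : con_le ker_xxy ker_xxx.
Proof. by move=> p q pq A VA _ [a ->]; apply: pq => //; exists a, a; rewrite env3_const. Qed.

Lemma left_maltsev_y : left_maltsev y.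
Proof. by []. Qed.

(** The term [y] acts as the identity, [d(z, x, y)] inverts [d], and [d'(x, z, d(x, z, y))] is the
    composite. *)
Lemma translation_rel_equiv : Equivalence translation_rel.
Proof.
split=> [p|p q [pq tpq]|p q r [pq tpq] [qr tqr]].
- by split; [exact: con_refl|exists y].
- split; [exact: con_sym|move=> Pq].
  have [d dl dpq] := tpq (projects_eq (con_sym pq) Pq).
  exists (subst (tnth [tuple z; x; y]) d) => [A VA a b|B beta VB bC a b ab].
    rewrite eval_subst -[RHS](dl A VA a b).
    by apply: eq_eval => -[[|[|[]]]].
  rewrite eval_subst (dpq B beta) //.
  rewrite -[LHS](translation_inverse VB bC (dl B VB) _ ab).
  by apply: eq_eval => -[[|[|[]]]].
split; [exact: con_trans pq qr|move=> Pp].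
have [d dl dpq] := tpq Pp; have [d' dl' dqr] := tqr (projects_eq pq Pp).
exists (subst (tnth [tuple x; z; d]) d') => [A VA a b|B beta VB bC a b ab].
  rewrite eval_subst -[RHS](dl' A VA a b).
  by apply: eq_eval => -[[|[|[|//]]] ?] //=; apply: dl.
rewrite eval_subst (dqr B beta) // (dpq B beta) //.
by apply: eq_eval => -[[|[|[]]]].
Qed.

(** At [(a, b, b)], terms related by [ker_xxx] take [beta]-related values, so [translation_matrix]
    carries the same [d] from the top row to the bottom row. *)
Lemma translation_rel_matrix p q r s :
  mx ker_xxy ker_xxx p q r s -> translation_rel p q -> translation_rel r s.
Proof.
move=> M [pq tpq]; have [pr qs] := mx_cols_rel M; split.
  exact: con_trans (con_sym pr) (con_trans pq qs).
move=> Pr; have [d dl dpq] := tpq (projects_eq (con_sym pr) Pr).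
exists d => // B beta VB bC a b ab.
have ker (u v : Tm3) : ker_xxx u v ->
    beta (eval (tnth [tuple a; b; b]) u) (eval (tnth [tuple a; b; b]) v).
  move=> uv; have H w : beta (eval (tnth [tuple a; b; b]) w) (eval (fun=> b) w).
    by apply: eval_con => -[[|[|[|//]]] ?] //; apply: con_refl.
  apply: con_trans (H u) _; rewrite (uv B VB); last by exists b.
  exact: con_sym.
apply: (translation_matrix VB bC (dl B VB) ab _ (dpq B beta VB bC a b ab)).
apply: mx_hom M => // u v uv; apply: ker => //.
exact: ker_xxy_le_xxx.
Qed.

Lemma polynomial_term (g : Tm3 -> Tm3) : polynomial g ->
  exists s : term S (option 'I_3), forall p,
    g p = eval (oapp (Var : _ -> Tm3) p) s.
Proof.
elim=> [|{}g f i c _ [s gs]]; first by exists (Var None).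
pose v j : term S (option 'I_3) :=
  if j == i then Var None else subst (fun k => Var (Some k)) (c j).
exists (subst (oapp (fun k => Var (Some k)) (App f v)) s) => p.
rewrite gs eval_subst; apply: eq_eval => -[k|] //=.
congr App; apply: functional_extensionality => j; rewrite /v.
by case: eqP => // _; rewrite eval_subst eval_term_algebra subst_Var.
Qed.

Lemma eval_polynomial_term (A : algebra S) (e : 'I_3 -> A) (p : Tm3) s :
  eval e (eval (oapp (Var : _ -> Tm3) p) s) = eval (oapp e (eval e p)) s.
Proof. by rewrite eval_term_algebra eval_subst; apply: eq_eval => -[]. Qed.

(* If [g (T(.., z_i, ..))] projects to [x] along [xxy], then renaming [x] and
   [y] in that equation, and letting the third variable in through the other
   side of the Taylor identity, yields the left Maltsev term [d] below. *)
Lemma taylor_translation i (w u : 'I_n -> bool) :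
  w i = true -> u i = false ->
  (forall A, V A -> forall a b : A,
     eval (fun j => if w j then a else b) T = eval (fun j => if u j then a else b) T) ->
  let c j : Tm3 := if w j then x else y in
  syn translation_rel_equiv (eval (upd c i x) T) (eval (upd c i z) T).
Proof.
move=> wi ui wu c.
set p := eval (upd c i x) T; set q := eval (upd c i z) T.
have pq : ker_xxy p q.
  apply: eval_con => j; rewrite /upd; case: (j =P i) => _; last exact: con_refl.
  by move=> A VA _ [a [b ->]].
apply: con_sym => g Pg.
have gpq := polynomial_con Pg pq; split; first exact: con_sym.
have [s gs] := polynomial_term Pg; rewrite !gs in gpq *.
move=> /(projects_eq (con_sym gpq)) Pgp.
have eval_p (A : algebra S) (a b : A) : V A -> eval (tnth [tuple a; a; b]) p =
    eval (fun j => if u j then a else b) T.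
  move=> VA; rewrite -wu // /p eval_term_algebra eval_subst.
  by apply: eq_eval => j; rewrite /upd /c; case: (j =P i) => [->|_]; [rewrite wi|case: (w j)].
have idg (A : algebra S) (a b : A) : V A ->
    eval (oapp (tnth [tuple a; a; b]) (eval (fun j => if u j then a else b) T)) s = a.
  by move=> VA; rewrite -[RHS](Pgp A VA a b) eval_polynomial_term eval_p.
pose c' j : term S 'I_3 := if j == i then x else if u j then y else z.
(* For [z := x] this becomes [idg] at [(y, x)], since [u i = false]; hence [d] is left Maltsev. *)
pose d : term S 'I_3 := subst (oapp (tnth [tuple y; y; z]) (subst c' T)) s.
have dl : left_maltsev d.
  move=> A VA a b; rewrite -[RHS](idg A b a VA) eval_subst; apply: eq_eval => -[[[|[|[|//]]] ?]|] //=.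
  rewrite eval_subst; apply: eq_eval => j; rewrite /c'.
  by case: (j =P i) => [->|_]; [rewrite ui|case: (u j)].
exists d => // B beta VB bC a b ab.
pose e3 := tnth [tuple a; b; b]; pose ca j := eval e3 (c j).
have ev k : eval e3 (eval (upd c i k : _ -> Tm3) T) = eval (upd ca i (eval e3 k)) T.
  rewrite eval_term_algebra eval_subst; apply: eq_eval => j.
  by rewrite /upd /ca; case: (j =P i).
(* The top row is [b], [d(a, b, b)]; the bottom row consists of the values of [g q] and [g p] at
   [(a, b, b)]. *)
have M : mx beta beta
    (eval (oapp (tnth [tuple b; b; b]) (eval (upd (fun=> b) i b) T)) s)
    (eval (oapp (tnth [tuple b; b; b]) (eval (upd (fun=> b) i a) T)) s)
    (eval (oapp e3 (eval (upd ca i b) T)) s)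
    (eval (oapp e3 (eval (upd ca i a) T)) s).
  have ba : beta b a by apply: con_sym.
  apply: mx_eval => -[[[|[|[|//]]] ?]|] /=; [exact: mx_row|exact/mx_row/con_refl..|].
  apply: mx_eval => j; rewrite /upd; case: (j =P i) => _; first exact: mx_col.
  apply: mx_row; rewrite /ca /c; case: (w j) => //; exact: con_refl.
rewrite !eval_polynomial_term -/e3 /p /q !ev.
apply: (translation_matrix VB bC _ ab M) => [a' b'|].
  exact: dl.
have -> : eval (oapp (tnth [tuple b; b; b]) (eval (upd (fun=> b) i b) T)) s = b.
  rewrite -[RHS](idg B b b VB); apply: eq_eval => -[//|] /=.
  by apply: eq_eval => j; rewrite /upd; case: (j =P i); case: (u j).
rewrite eval_subst; apply: eq_eval => -[[[|[|[|//]]] ?]|] //=.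
rewrite eval_subst; apply: eq_eval => j; rewrite /c' /upd.
by case: (j =P i) => // _; case: (u j).
Qed.

Lemma comparable_difference_term :
  is_variety V -> commutator_commutative_comparable V -> has_difference_term V.
Proof.
move=> hV comm.
pose eps := syn translation_rel_equiv.
have le_xxy : con_le eps ker_xxy by move=> p q /syn_le [].
have le_xxx : con_le eps ker_xxx by move=> p q /le_xxy /ker_xxy_le_xxx.
have eq_eps : con_le (eq_con V (ord0 : 'I_3) (fun A e => True)) eps.
  apply: le_syn => p q pq; split=> [A VA e _|Pp]; first exact: pq.
  by exists y => [|B beta VB _ a b _]; [exact: left_maltsev_y|rewrite (pq B VB)].
have Vq : V (quot eps).
  apply: quot_variety => // p q pq e; apply: eq_eps => A VA f _.
  by rewrite !eval_term_algebra !eval_subst pq.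
(* The commutator is swapped in the quotient by [eps], which lies in [V], and the result is pulled
   back. *)
have C : centralizes ker_xxx ker_xxy eps.
  have C0 : con_eq (commutator (quot_con le_xxy) (quot_con le_xxx)) (con0 (quot eps)).
    apply/commutator_eq0/quot_centralizes; apply: syn_centralizes => p q r s.
    exact: translation_rel_matrix.
  apply/(quot_centralizes le_xxx le_xxy)/commutator_eq0 => a b.
  apply: iff_trans (C0 a b); apply: iff_sym; apply: (comm _ Vq) => p q.
  exact: ker_xxy_le_xxx.
have xz : ker_xxy x z by move=> A VA _ [a [b ->]].
have : eps (eval (fun=> x : Tm3) T) (eval (fun=> z : Tm3) T).
  apply: (taylor_cancel C (ker_xxy_le_xxx xz) xz) => i.
  have [w [u [wi ui wu]]] := taylor_bool i.
  exists (fun j => if w j then x else y); last exact: taylor_translation wi ui wu.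
  by move=> j A VA _ [a ->]; case: (w j).
have idT (v : Tm3) : eps (eval (fun=> v) T) v.
  apply: eq_eps => A VA e _; rewrite eval_term_algebra eval_subst.
  exact: taylor_idempotent.
(* In the order [(z, x)], evaluation at [(a, b, b)] turns the translation into [a = d(a, b, b)]. *)
move=> /(con_trans (con_sym (idT _))) /con_trans /(_ (idT _)) /con_sym /syn_le [_ [//|d dl dzx]].
exists d; split=> [A VA e|B VB alpha a b /commutator_eq0 C' ab].
  rewrite eval_subst -[RHS](dl A VA (e 0)).
  by apply: eq_eval => j; rewrite (env3_comp (eval _)).
exact/esym/(dzx B alpha).
Qed.


End TaylorVariety.
Theorem theorem4p29 (S : signature) (V : algebra S -> Prop)
    (hV : is_variety V) :
  [<-> has_difference_term V;
       has_taylor_term V /\ commutator_commutative V;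
       has_taylor_term V /\ commutator_commutative_comparable V].
Proof.
tfae.
- move=> hd; split; first exact: difference_term_taylor.
  exact: difference_term_commutative.
- by move=> [hT comm]; split=> // A VA x y _; apply: comm.
- by move=> [[n [T [_ hT]]] comm]; apply: comparable_difference_term hT hV comm.
Qed.
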